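(* Every connected claw-free cubic graph not isomorphic to $K_4$ has a disconnecting perfect matching.
   Context: All graphs are finite and simple. A graph is claw-free if it has no induced subgraph isomorphic to $K_{1,3}$. A perfect matching $M$ of $G$ is disconnecting (separating) if $G-M$ has more connected components than $G$. *)

(* Defs.v *)
From mathcomp Require Import all_boot.
Set Implicit Arguments.
Unset Strict Implicit.
Unset Printing Implicit Defensive.

Record sgraph := SGraph {
  vertex :> finType;
  adj : rel vertex;
  adj_sym : symmetric adj;
  adj_irrefl : irreflexive adj }.

Definition graph_iso (G H : sgraph) : Prop :=
  exists2 f : G -> H, bijective f & forall x y, adj (f x) (f y) = adj x y.

Section Induced.
Variables (G : sgraph) (S : {set G}).

Definition induced_adj : rel {x : G | x \in S} :=
  fun x y => adj (val x) (val y).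

Lemma induced_sym : symmetric induced_adj.
Proof. by move=> x y; apply: adj_sym. Qed.

Lemma induced_irrefl : irreflexive induced_adj.
Proof. by move=> x; apply: adj_irrefl. Qed.

Definition induced : sgraph := SGraph induced_sym induced_irrefl.
End Induced.

Section Complete.
Variable n : nat.

Definition complete_adj : rel 'I_n := fun x y => x != y.

Lemma complete_sym : symmetric complete_adj.
Proof. by move=> x y; rewrite /complete_adj eq_sym. Qed.

Lemma complete_irrefl : irreflexive complete_adj.
Proof. by move=> x; rewrite /complete_adj eqxx. Qed.

Definition complete : sgraph := SGraph complete_sym complete_irrefl.
End Complete.

Section CompleteBipartite.
Variables m n : nat.

Definition bipartite_adj : rel ('I_m + 'I_n)%type :=
  fun x y => match x, y with
             | inl _, inr _ | inr _, inl _ => true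
             | _, _ => false
             end.

Lemma bipartite_sym : symmetric bipartite_adj.
Proof. by case=> x; case. Qed.

Lemma bipartite_irrefl : irreflexive bipartite_adj.
Proof. by case. Qed.

Definition complete_bipartite : sgraph := SGraph bipartite_sym bipartite_irrefl.
End CompleteBipartite.

Definition claw_free (G : sgraph) : Prop :=
  forall S : {set G}, ~ graph_iso (induced S) (complete_bipartite 1 3).

Definition cubic (G : sgraph) : Prop :=
  forall x : G, #|[set y | adj x y]| = 3.

Definition num_components (G : sgraph) : nat := n_comp (@adj G) G.

(* The null graph has no component, hence is not connected. *)
Definition connected (G : sgraph) : Prop := num_components G = 1.

Definition edges (G : sgraph) : {set {set G}} :=
  [set [set p.1; p.2] | p in [set p : G * G | adj p.1 p.2]].

Definition perfect_matching (G : sgraph) (M : {set {set G}}) : Prop :=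
  M \subset edges G /\ forall x : G, #|[set A in M | x \in A]| = 1.

Section DelEdges.
Variables (G : sgraph) (M : {set {set G}}).

Definition del_edges_adj : rel G :=
  fun x y => adj x y && ([set x; y] \notin M).

Lemma del_edges_sym : symmetric del_edges_adj.
Proof. by move=> x y; rewrite /del_edges_adj adj_sym setUC. Qed.

Lemma del_edges_irrefl : irreflexive del_edges_adj.
Proof. by move=> x; rewrite /del_edges_adj adj_irrefl. Qed.

Definition del_edges : sgraph := SGraph del_edges_sym del_edges_irrefl.
End DelEdges.

Definition disconnecting (G : sgraph) (M : {set {set G}}) : Prop :=
  num_components G < num_components (del_edges M).

(* Main.v *)
Require Import Defs.
From mathcomp Require Import all_boot.

(** Every vertex of a connected claw-free cubic graph other than [K4] lies in
    exactly one block, which is an induced triangle or an induced diamond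
    ([K4] minus an edge).  The edges between blocks together with the central
    edges of the diamonds form a perfect matching, and removing it leaves the
    disjoint union of the triangles and of the outer 4-cycles of the diamonds.
    The removed edges are precisely those whose ends do not have exactly one
    common neighbour. *)

Set Implicit Arguments.
Unset Strict Implicit.
Unset Printing Implicit Defensive.

(** * Codegrees and the set of edges of codegree other than 1 *)

Definition codegree (G : sgraph) (x y : G) : nat :=
  #|[set z | adj x z && adj y z]|.

Definition matching_edge (G : sgraph) : rel G :=
  fun x y => adj x y && (codegree x y != 1).

Definition codegree_matching (G : sgraph) : {set {set G}} :=
  [set [set p.1; p.2] | p in [set p : G * G | matching_edge p.1 p.2]].

Lemma codegreeC (G : sgraph) (x y : G) : codegree x y = codegree y x.
Proof. by apply: eq_card => z; rewrite !inE andbC. Qed.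

Lemma matching_edgeC (G : sgraph) (x y : G) :
  matching_edge x y = matching_edge y x.
Proof. by rewrite /matching_edge adj_sym codegreeC. Qed.

(** Either ordering of the pair may represent the edge in the image set; symmetry of [matching_edge]
    makes the choice harmless. *)
Lemma mem_codegree_matching (G : sgraph) (x y : G) :
  ([set x; y] \in codegree_matching G) = matching_edge x y.
Proof.
apply/imsetP/idP => [[[u v]] | xy]; last by exists (x, y); rewrite ?inE.
rewrite inE /= => uv e.
have neq_uv : u != v.
  by apply: contraTneq uv => ->; rewrite /matching_edge adj_irrefl.
have : u \in [set x; y] by rewrite e set21.
have : v \in [set x; y] by rewrite e set22.
case/set2P=> ev /set2P[] eu; subst; rewrite ?eqxx // in neq_uv *.
by rewrite matching_edgeC.
Qed.

(** * Counting in neighbourhoods, reachability, and claws *)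

Section Neighbourhoods.
Variable G : sgraph.
Implicit Types x y z a b c : G.

Lemma adj_neq x y : adj x y -> x != y.
Proof. by apply: contraTneq => ->; rewrite adj_irrefl. Qed.

(** For [y] among [a], [b], [c], this turns the codegree into the degree of [y] in the graph induced
    on the neighbourhood of [x]. *)
Lemma codegreeE x y a b c :
  uniq [:: a; b; c] -> adj x =1 mem [:: a; b; c] ->
  codegree x y = adj y a + (adj y b + adj y c).
Proof.
move=> U Nx; rewrite /codegree.
transitivity (count (adj y) [:: a; b; c]); last by rewrite /= addn0.
rewrite -size_filter -(card_uniqP (filter_uniq _ U)).
by apply: eq_card => z; rewrite inE mem_filter Nx andbC.
Qed.

Lemma components_le1_connect (e : rel G) :
  connect_sym e -> n_comp e G <= 1 -> forall x y, connect e x y.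
Proof.
move=> se /card_le1_eqP le1 x y.
rewrite -(root_connect se); apply/eqP/le1; by rewrite inE /= roots_root.
Qed.

(** With at most one component every vertex is reachable from [x], and paths never leave the closed
    set [S]. It serves both for [G] and for [G] with the matching removed. *)
Lemma closed_set_full (e : rel G) (S : seq G) x :
  symmetric e -> n_comp e G <= 1 -> x \in S ->
  (forall u v, u \in S -> e u v -> v \in S) -> #|G| <= size S.
Proof.
move=> se le1 xS clS.
have cs : connect_sym e by exact: sym_connect_sym.
have cl : closed e (mem S).
  by apply: intro_closed => // u v uv uS; apply: clS uS uv.
suff <- : #|S| = #|G| by exact: card_size.
apply: eq_card => y; rewrite [RHS]inE.
by rewrite -(closed_connect cl (components_le1_connect cs le1 x y)).
Qed.

Lemma induced_claw x a b c :
  uniq [:: a; b; c] -> adj x a -> adj x b -> adj x c ->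
  ~~ adj a b -> ~~ adj a c -> ~~ adj b c ->
  graph_iso (induced [set z in [:: x; a; b; c]]) (complete_bipartite 1 3).
Proof.
move=> U xa xb xc ab ac bc.
have [xNa xNb xNc] := And3 (adj_neq xa) (adj_neq xb) (adj_neq xc).
have U4 : uniq [:: x; a; b; c].
  by rewrite cons_uniq U andbT !inE !negb_or xNa xNb.
have E z : z \in [set z in [:: x; a; b; c]] -> [\/ z = x, z = a, z = b | z = c].
  by rewrite !inE => /or4P[] /eqP->;
    [constructor 1|constructor 2|constructor 3|constructor 4].
(* The centre goes to the one-vertex side, the leaves to the other; the last branch only ever
   receives [c]. *)
pose f (u : induced [set z in [:: x; a; b; c]]) : complete_bipartite 1 3 :=
  if val u == x then inl ord0 else
  if val u == a then inr ord0 else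
  if val u == b then inr (inord 1) else inr (inord 2).
have [aNb aNc bNc] : [/\ a != b, a != c & b != c].
  by move: U; rewrite /= !inE negb_or andbT => /andP[/andP[]].
have fx u : val u = x -> f u = inl ord0 by rewrite /f => ->; rewrite eqxx.
have fa u : val u = a -> f u = inr ord0.
  by rewrite /f => ->; rewrite eqxx eq_sym (negbTE xNa).
have fb u : val u = b -> f u = inr (inord 1).
  by rewrite /f => ->; rewrite eqxx eq_sym (negbTE xNb) eq_sym (negbTE aNb).
have fc u : val u = c -> f u = inr (inord 2).
  rewrite /f => ->.
  by rewrite eq_sym (negbTE xNc) eq_sym (negbTE aNc) eq_sym (negbTE bNc).
have n01 : (ord0 : 'I_3) = inord 1 -> False.
  by move/(congr1 val); rewrite /= inordK.
have n02 : (ord0 : 'I_3) = inord 2 -> False.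
  by move/(congr1 val); rewrite /= inordK.
have n12 : (inord 1 : 'I_3) = inord 2 -> False.
  by move/(congr1 val); rewrite /= !inordK.
exists f.
  apply: inj_card_bij => [u v fuv|].
    apply: val_inj; move: fuv.
    case: (E _ (valP u)) => eu; case: (E _ (valP v)) => ev;
      rewrite eu ev // ?(fx _ eu) ?(fa _ eu) ?(fb _ eu) ?(fc _ eu)
        ?(fx _ ev) ?(fa _ ev) ?(fb _ ev) ?(fc _ ev);
      by case=> // /esym; try case/n01; try case/n02; try case/n12; move/esym.
  by rewrite card_sum !card_ord card_sig cardsE (card_uniqP U4).
have [ba ca cb] : [/\ ~~ adj b a, ~~ adj c a & ~~ adj c b].
  by split; rewrite adj_sym.
have [ax bx cx] : [/\ adj a x, adj b x & adj c x] by split; rewrite adj_sym.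
move=> u v; rewrite /= /induced_adj.
case: (E _ (valP u)) => eu; case: (E _ (valP v)) => ev;
  rewrite eu ev // ?(fx _ eu) ?(fa _ eu) ?(fb _ eu) ?(fc _ eu)
    ?(fx _ ev) ?(fa _ ev) ?(fb _ ev) ?(fc _ ev) /= ?adj_irrefl;
  by rewrite ?xa ?xb ?xc ?ax ?bx ?cx; do ?apply/esym/negbTE.
Qed.

(** * Cubic graphs and recognition of [K4] *)

Section Cubic.
Hypothesis Gcubic : cubic G.

Lemma neighboursP x :
  exists a b c, uniq [:: a; b; c] /\ adj x =1 mem [:: a; b; c].
Proof.
have := Gcubic x; rewrite cardE.
have := enum_uniq [set y | adj x y].
have : mem (enum [set y | adj x y]) =1 adj x by move=> y; rewrite /= mem_enum inE.
case: (enum _) => [|a [|b [|c [|]]]] // Nx U _.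
by exists a, b, c; split=> // y; rewrite Nx.
Qed.

Lemma neighboursE x a b c :
  uniq [:: a; b; c] -> adj x a -> adj x b -> adj x c ->
  adj x =1 mem [:: a; b; c].
Proof.
move=> U xa xb xc y.
have : [set z in [:: a; b; c]] == [set z | adj x z].
  rewrite eqEcard Gcubic cardsE (card_uniqP U) andbT.
  by apply/subsetP=> z; rewrite !inE => /or3P[]/eqP->.
by move/eqP/setP/(_ y); rewrite !inE.
Qed.

Lemma cubic_card_le4 (x : G) : #|G| <= 4 -> graph_iso G (complete 4).
Proof.
move=> le4.
(* The three neighbours of [y] lie in [[set~ y]], which has at most three elements, so the two sets
   coincide. *)
have full y : [set z | adj y z] = [set~ y].
  apply/eqP; rewrite eqEcard Gcubic cardsC1 -subn1 leq_subLR le4 andbT.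
  by apply/subsetP=> z; rewrite !inE eq_sym => /adj_neq.
have e4 : #|G| = 4.
  apply/eqP; rewrite eqn_leq le4 /=.
  by have := cardsC1 x; rewrite -full Gcubic; case: #|_| => // n [->].
exists (fun z => cast_ord e4 (enum_rank z)).
  apply: inj_card_bij; last by rewrite card_ord e4.
  by move=> y z /cast_ord_inj/enum_rank_inj.
move=> y z; rewrite /= /complete_adj (inj_eq (@cast_ord_inj _ _ e4)).
rewrite (inj_eq enum_rank_inj).
by have /setP/(_ z) := full y; rewrite !inE eq_sym => ->.
Qed.

(** * The graph induced on a neighbourhood *)

Hypothesis Gconn : connected G.
Hypothesis Gclaw : claw_free G.
Hypothesis GnK4 : ~ graph_iso G (complete 4).

Lemma no_small_closed_set (S : seq G) x :
  size S <= 4 -> x \in S -> (forall u v, u \in S -> adj u v -> v \in S) ->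
  False.
Proof.
move=> sS xS clS; apply: GnK4; apply: (cubic_card_le4 x).
apply: leq_trans sS; apply: (closed_set_full _ _ xS clS); first exact: adj_sym.
by have := Gconn; rewrite /connected /num_components => ->.
Qed.

(** Otherwise [x], [a], [b], [c] would already have all their neighbours among themselves, making up
    the whole connected graph, hence [K4]. *)
Lemma not_complete_neighbourhood x a b c :
  uniq [:: a; b; c] -> adj x =1 mem [:: a; b; c] ->
  ~~ [&& adj a b, adj a c & adj b c].
Proof.
move=> U Nx; apply/negP=> /and3P[ab ac bc].
have xa : adj x a by rewrite Nx !inE eqxx.
have xb : adj x b by rewrite Nx !inE eqxx orbT.
have xc : adj x c by rewrite Nx !inE eqxx !orbT.
have sub y p q r : uniq [:: p; q; r] -> adj y p -> adj y q -> adj y r ->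
    {subset [:: p; q; r] <= [:: x; a; b; c]} ->
    forall v, adj y v -> v \in [:: x; a; b; c].
  by move=> U' p1 p2 p3 H v; rewrite (neighboursE U' p1 p2 p3) => /H.
have [aNb aNc bNc] := And3 (adj_neq ab) (adj_neq ac) (adj_neq bc).
have [xNa xNb xNc] := And3 (adj_neq xa) (adj_neq xb) (adj_neq xc).
apply: (@no_small_closed_set [:: x; a; b; c] x) => //; first exact: mem_head.
move=> u v uS.
have : [|| u == x, u == a, u == b | u == c] by move: uS; rewrite !inE.
case/or4P=> /eqP->.
- by rewrite Nx => xv; rewrite inE; apply/orP; right.
- apply: (@sub _ x b c); rewrite /= ?inE ?negb_or ?xNb ?xNc ?bNc // 1?adj_sym //.
  by move=> z; rewrite !inE => /or3P[] ->; rewrite ?orbT.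
- apply: (@sub _ x a c); rewrite /= ?inE ?negb_or ?xNa ?xNc ?aNc // 1?adj_sym //.
  by move=> z; rewrite !inE => /or3P[] ->; rewrite ?orbT.
- apply: (@sub _ x a b); rewrite /= ?inE ?negb_or ?xNa ?xNb ?aNb // 1?adj_sym //.
  by move=> z; rewrite !inE => /or3P[] ->; rewrite ?orbT.
Qed.

(** The graph on the three neighbours has an edge, by claw-freeness, and is not a triangle. So it is
    a path or a single edge plus an isolated vertex, and [a] is a vertex of degree 1 in it. *)
Lemma neighbourhoodP x :
  exists a b c, [/\ uniq [:: a; b; c], adj x =1 mem [:: a; b; c],
                    adj a b & ~~ adj a c].
Proof.
have [a [b [c [U Nx]]]] := neighboursP x.
have N3 := not_complete_neighbourhood U Nx.
have claw : [|| adj a b, adj a c | adj b c].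
  apply/negPn/negP; rewrite !negb_or => /and3P[ab ac bc].
  by apply: Gclaw (@induced_claw x _ _ _ U _ _ _ ab ac bc);
    rewrite Nx !inE eqxx ?orbT.
have reorder p q r : perm_eq [:: p; q; r] [:: a; b; c] ->
    adj p q -> ~~ adj p r ->
  exists a b c, [/\ uniq [:: a; b; c], adj x =1 mem [:: a; b; c],
                    adj a b & ~~ adj a c].
  move=> pe pq pr; exists p, q, r; split=> //; first by rewrite (perm_uniq pe).
  by move=> y; rewrite Nx /= (perm_mem pe).
have bac : perm_eq [:: b; a; c] [:: a; b; c].
  exact: (permEl (perm_catCA [:: b] [:: a] [:: c])).
have acb : perm_eq [:: a; c; b] [:: a; b; c].
  by rewrite perm_cons; apply: (permEl (perm_catC [:: c] [:: b])).
have bca : perm_eq [:: b; c; a] [:: a; b; c].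
  by rewrite -(perm_rot 2 [:: b; c; a]).
case ab: (adj a b) claw N3 => /=.
  case ac: (adj a c) => /= _ bc; last first.
    by apply: (reorder a b c) => //; rewrite ac.
  by apply: (reorder b a c) => //; rewrite adj_sym.
case ac: (adj a c) => /= bc _; first by apply: (reorder a c b); rewrite ?ac ?ab.
by apply: (reorder b c a); rewrite // adj_sym ab.
Qed.

(** * The matching is perfect *)

Lemma mateP x : exists m, matching_edge x =1 pred1 m.
Proof.
have [a [b [c [U Nx ab ac]]]] := neighbourhoodP x.
have [aNb aNc bNc] : [/\ a != b, a != c & b != c].
  by move: U; rewrite /= !inE negb_or andbT => /andP[/andP[]].
(* If [b] and [c] are adjacent, the neighbourhood is the path [a], [b], [c] with degrees 1, 2, 1;
   otherwise the degrees are 1, 1, 0. Either way exactly one neighbour has degree other than 1. *)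
exists (if adj b c then b else c) => y; rewrite /matching_edge Nx /= !inE.
rewrite (codegreeE y U Nx).
have [->|ya] := eqVneq y a.
  by rewrite adj_irrefl ab (negbTE ac) /=; case: ifP; rewrite ?(negbTE aNb) ?(negbTE aNc).
have [->|yb] := eqVneq y b.
  by rewrite adj_irrefl adj_sym ab /=; case: (adj b c); rewrite ?eqxx ?(negbTE bNc).
have [->|yc] /= := eqVneq y c.
  rewrite adj_irrefl adj_sym (negbTE ac) adj_sym /=.
  by case: (adj b c); rewrite ?eqxx // eq_sym (negbTE bNc).
by case: ifP; rewrite ?(negbTE yb) ?(negbTE yc).
Qed.

Lemma codegree_matching_perfect : perfect_matching (codegree_matching G).
Proof.
split=> [|x].
  apply/subsetP=> A /imsetP[p]; rewrite inE => /andP[pp _] ->.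
  by apply/imsetP; exists p; rewrite ?inE.
have [m xm] := mateP x.
apply/eqP/cards1P; exists [set x; m]; apply/setP=> A; rewrite !inE.
apply/andP/eqP=> [[]|->]; last by rewrite mem_codegree_matching xm /= set21 eqxx.
case/imsetP=> -[u v]; rewrite inE /= => uv -> /set2P[e|e]; subst.
  by move: uv; rewrite xm => /eqP->.
by move: uv; rewrite matching_edgeC xm => /eqP->; rewrite setUC.
Qed.

(** * Triangle and diamond blocks, and disconnection *)

Lemma codegree1_neighbours x p q y :
  p != q -> adj x p -> codegree x p = 1 -> adj x q -> codegree x q = 1 ->
  adj x y -> codegree x y = 1 -> y \in [:: p; q].
Proof.
move=> pq xp cp xq cq xy cy; rewrite !inE; apply/negPn/negP.
rewrite negb_or => /andP[yp yq].
have U : uniq [:: p; q; y] by rewrite /= !inE negb_or pq eq_sym yp eq_sym yq.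
(* Three distinct neighbours of codegree 1 would exhaust the neighbourhood and leave no place for
   the mate of [x]. *)
have [m xm] := mateP x.
have : matching_edge x m by rewrite xm /= eqxx.
case/andP; rewrite (neighboursE U xp xq xy) !inE.
by case/or3P=> /eqP->; rewrite ?cp ?cq ?cy.
Qed.

(** [S] is the block of [x]. Closure is required only along edges of codegree 1, which are exactly
    those surviving removal of the matching. *)
Lemma small_block x :
  exists S : seq G, [/\ size S <= 4, x \in S &
    forall u v, u \in S -> adj u v -> codegree u v = 1 -> v \in S].
Proof.
have [a [b [c [U Nx ab ac]]]] := neighbourhoodP x.
have [aNb aNc bNc] : [/\ a != b, a != c & b != c].
  by move: U; rewrite /= !inE negb_or andbT => /andP[/andP[]].
have xa : adj x a by rewrite Nx !inE eqxx.
have xb : adj x b by rewrite Nx !inE eqxx orbT.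
have xc : adj x c by rewrite Nx !inE eqxx !orbT.
have [xNa xNb xNc] := And3 (adj_neq xa) (adj_neq xb) (adj_neq xc).
have [ax bx cx] : [/\ adj a x, adj b x & adj c x] by split; rewrite adj_sym.
have ba : adj b a by rewrite adj_sym.
have cxa : codegree x a = 1 by rewrite (codegreeE _ U Nx) adj_irrefl ab (negbTE ac).
have cax := etrans (codegreeC a x) cxa.
(* [sub2] treats a vertex with two known codegree-1 neighbours in [S], [sub3] a vertex with all its
   neighbours in [S]. *)
have sub2 p q (S : seq G) u v : p != q -> adj u p -> codegree u p = 1 ->
    adj u q -> codegree u q = 1 -> p \in S -> q \in S ->
    adj u v -> codegree u v = 1 -> v \in S.
  move=> pq up cp uq cq pS qS uv cv.
  by have := codegree1_neighbours pq up cp uq cq uv cv;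
      rewrite !inE => /orP[]/eqP->.
have sub3 p q r (S : seq G) u v : uniq [:: p; q; r] ->
    adj u p -> adj u q -> adj u r -> p \in S -> q \in S -> r \in S ->
    adj u v -> v \in S.
  move=> U3 up uq ur pS qS rS; rewrite (neighboursE U3 up uq ur) !inE.
  by case/or3P=> /eqP->.
(* Here [x] and [b] are the ends of the central edge of a diamond with outer vertices [a] and
   [c]. *)
case bc: (adj b c).
  have cb : adj c b by rewrite adj_sym.
  have Ub : uniq [:: x; a; c] by rewrite /= !inE negb_or xNa xNc aNc.
  have Nb := neighboursE Ub bx ba bc.
  have cab : codegree a b = 1.
    by rewrite codegreeC (codegreeE _ Ub Nb) ax adj_irrefl (negbTE ac).
  have ccx : codegree c x = 1.
    by rewrite codegreeC (codegreeE _ U Nx) cb adj_irrefl adj_sym (negbTE ac).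
  have ccb : codegree c b = 1.
    by rewrite codegreeC (codegreeE _ Ub Nb) cx adj_irrefl adj_sym (negbTE ac).
  exists [:: x; a; b; c]; split=> // [|u v]; first exact: mem_head.
  rewrite inE => /predU1P[->|].
    by move=> xv _; apply: (sub3 a b c _ _ _ U xa xb xc) xv; rewrite !inE eqxx ?orbT.
  rewrite !inE => /or3P[] /eqP-> uv cuv.
  - by have := sub2 x b [:: x; a; b; c] a v xNb ax cax ab cab;
      rewrite !inE !eqxx ?orbT; apply.
  - by have := sub3 x a c [:: x; a; b; c] b v Ub bx ba bc;
      rewrite !inE !eqxx ?orbT; apply.
  - by have := sub2 x b [:: x; a; b; c] c v xNb cx ccx cb ccb;
      rewrite !inE !eqxx ?orbT; apply.
have cxb : codegree x b = 1 by rewrite (codegreeE _ U Nx) adj_irrefl ba bc.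
have cbx := etrans (codegreeC b x) cxb.
(* Now [x], [a], [b] form a triangle. It is a whole block exactly when [x] is the only common
   neighbour of [a] and [b]. *)
have [cab|cab] := eqVneq (codegree a b) 1.
  have cba := etrans (codegreeC b a) cab.
  exists [:: x; a; b]; split=> // [|u v]; first exact: mem_head.
  rewrite !inE => /or3P[] /eqP-> uv cuv.
  - by have := sub2 a b [:: x; a; b] x v aNb xa cxa xb cxb;
      rewrite !inE !eqxx ?orbT; apply.
  - by have := sub2 x b [:: x; a; b] a v xNb ax cax ab cab;
      rewrite !inE !eqxx ?orbT; apply.
  - by have := sub2 x a [:: x; a; b] b v xNa bx cbx ba cba;
      rewrite !inE !eqxx ?orbT; apply.
(* A second common neighbour [d] gives a diamond with central edge [ab] and outer vertices [x] and
   [d]. *)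
have [d dNx [ad bd]] : exists2 d, d != x & adj a d /\ adj b d.
  have xab : x \in [set z | adj a z && adj b z] by rewrite inE ax bx.
  move: cab; rewrite /codegree (cardsD1 x) xab -[X in _ != X]addn0 eqn_add2l cards_eq0.
  by case/set0Pn=> d; rewrite !inE => /and3P[dx ad bd]; exists d.
have [aNd bNd] := conj (adj_neq ad) (adj_neq bd).
have da : adj d a by rewrite adj_sym.
have db : adj d b by rewrite adj_sym.
(* A neighbour of [x] is [a], [b] or [c]; [d] differs from [a] and [b], and from [c] because only
   [d] is adjacent to [a]. *)
have dx : ~~ adj d x.
  rewrite adj_sym Nx !inE !negb_or eq_sym aNd eq_sym bNd /=.
  by apply: contraNneq ac => <-.
have Ua : uniq [:: x; b; d] by rewrite /= !inE negb_or xNb bNd andbT eq_sym dNx.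
have Ub : uniq [:: x; a; d] by rewrite /= !inE negb_or xNa aNd andbT eq_sym dNx.
have Na := neighboursE Ua ax ab ad.
have Nb := neighboursE Ub bx ba bd.
have cda : codegree d a = 1.
  by rewrite codegreeC (codegreeE _ Ua Na) (negbTE dx) db adj_irrefl.
have cdb : codegree d b = 1.
  by rewrite codegreeC (codegreeE _ Ub Nb) (negbTE dx) da adj_irrefl.
exists [:: x; a; b; d]; split=> // [|u v]; first exact: mem_head.
rewrite !inE => /or4P[] /eqP-> uv cuv.
- by have := sub2 a b [:: x; a; b; d] x v aNb xa cxa xb cxb;
    rewrite !inE !eqxx ?orbT; apply.
- by have := sub3 x b d [:: x; a; b; d] a v Ua ax ab ad;
    rewrite !inE !eqxx ?orbT; apply.
- by have := sub3 x a d [:: x; a; b; d] b v Ub bx ba bd;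
    rewrite !inE !eqxx ?orbT; apply.
- by have := sub2 a b [:: x; a; b; d] d v aNb da cda db cdb;
    rewrite !inE !eqxx ?orbT; apply.
Qed.

Lemma codegree_matching_disconnecting : disconnecting (codegree_matching G).
Proof.
rewrite /disconnecting Gconn ltnNge; apply/negP=> le1.
(* Having exactly one component supplies a vertex. If removal left at most one component, the block
   of that vertex would be all of [G], giving at most four vertices and hence [K4]. *)
have [x _] : exists x, x \in [predI roots (@adj G) & G].
  by apply/card_gt0P; move: Gconn; rewrite /connected /num_components /n_comp_mem => ->.
have [S [sS xS clS]] := small_block x.
apply: GnK4; apply: (cubic_card_le4 x); apply: leq_trans sS.
apply: (closed_set_full (@del_edges_sym G (codegree_matching G)) le1 xS).
move=> u v uS /andP[uv]; rewrite mem_codegree_matching /matching_edge uv /=.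
by rewrite negbK => /eqP; apply: clS.
Qed.

End Cubic.
End Neighbourhoods.

Theorem theorem6 (G : sgraph) (Gconn : connected G) (Gclaw : claw_free G)
    (Gcubic : cubic G) (GnK4 : ~ graph_iso G (complete 4)) :
  exists M : {set {set G}}, perfect_matching M /\ disconnecting M.
Proof.
exists (codegree_matching G); split.
- exact: codegree_matching_perfect.
- exact: codegree_matching_disconnecting.
Qed.
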